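(* Let $\mu$ be a positive, finite, compactly supported Borel measure on $\mathbb{C}$ with infinite support, let $x\in\mathbb{C}$ satisfy $$\lim_{n\to\infty}\frac{|p_n(x;\mu)|^2}{\sum_{j=0}^{n-1}|p_j(x;\mu)|^2}=0,$$ and let $\nu^x$ be the measure $d\nu^x(z)=|z-x|^2\,d\mu(z)$. Then $$\lim_{n\to\infty}\frac{(z-x)\,p_{n-1}(z;\nu^x)}{p_n(z;\mu)}=1$$ uniformly on compact subsets of $\overline{\mathbb{C}}\setminus\mathrm{ch}(\mu)$.
   Context: $\overline{\mathbb{C}}$ is the Riemann sphere. For a positive, finite, compactly supported measure $\lambda$ with infinite support, $p_n(z;\lambda)$ is the degree-$n$ orthonormal polynomial of $\lambda$, with positive leading coefficient: $\int \overline{p_n(z;\lambda)}\,p_m(z;\lambda)\,d\lambda(z)=\delta_{nm}$. $\mathrm{ch}(\mu)$ is the convex hull of $\mathrm{supp}(\mu)$. The quotient is regarded as analytic at $\infty$, with value the ratio of leading coefficients. *)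

(* Defs.v *)
From HB Require Import structures.
From mathcomp Require Import all_boot all_order all_algebra.
From mathcomp Require Import complex.
From mathcomp Require Import all_classical all_reals all_analysis.
From mathcomp Require Import measurable_realfun.

Set Implicit Arguments.
Unset Strict Implicit.
Unset Printing Implicit Defensive.

Import Order.TTheory GRing.Theory Num.Theory.
Import numFieldNormedType.Exports.

Local Open Scope classical_set_scope.
Local Open Scope ring_scope.
Local Open Scope complex_scope.

(* The library puts the metric topology on [K] only for an abstract
   [K : numFieldType] (and on the regular module [K^o]); this transports it to
   the concrete field [R[i]]. *)
HB.instance Definition _ (R : rcfType) := NormedModule.copy R[i] R[i]^o.

Notation normc := ComplexField.Normc.normc.

Definition borelC (R : realType) := g_sigma_algebraType (@open R[i]).

Definition riemann_sphere (R : realType) := one_point_compactification R[i].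

Lemma normc_sub_continuous (R : realType) (x : R[i]) :
  continuous (fun z : R[i] => normc (z - x)).
Proof.
move=> z; apply/(@cvgrPdist_lt _ _ _ (nbhs z)) => e e0.
exists e%:C => /= [|w zw]; first by rewrite ltcR.
rewrite -ltcR; apply: le_lt_trans zw.
have -> : z - w = (z - x) - (w - x) by rewrite opprB addrA subrK.
rewrite (_ : _%:C = `| `|z - x| - `|w - x| |) ?ler_dist_dist//.
by rewrite -rmorphB/= -[RHS]/((normc _)%:C)/= expr0n/= addr0 sqrtr_sqr.
Qed.

Section measures_on_the_plane.
Context {R : realType}.
Implicit Types (mu : {measure set (borelC R) -> \bar R}).

Definition supp mu : set R[i] :=
  [set z | forall U : set R[i], open U -> U z -> (0 < mu U)%E].

(* [Rcomplex R] is [R[i]] with its real vector space structure. *)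
Definition ch mu : set R[i] := smallest (@convex_set R (Rcomplex R)) (supp mu).

Definition Cintegral mu (f : R[i] -> R[i]) : R[i] :=
  (\int[mu]_z complex.Re (f z)) +i* (\int[mu]_z complex.Im (f z)).

(* In [R[i]], [0 < c] means that [c] is real and positive. *)
Definition orthonormal_polys mu (p : nat -> {poly R[i]}) : Prop :=
  [/\ forall n, size (p n) = n.+1,
      forall n, 0 < lead_coef (p n) &
      forall n m, Cintegral mu (fun z => ((p n).[z])^* * (p m).[z])
                  = (n == m)%:R].

(* For a compactly supported finite measure with infinite support, there is
   exactly one sequence satisfying [orthonormal_polys mu]; for the measures for
   which there is none, the value is the zero sequence. *)
Definition orthonormal_poly mu : nat -> {poly R[i]} :=
  xget (fun=> 0) [set p | orthonormal_polys mu p].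

Section christoffel_transform.
Variables (mu : {measure set (borelC R) -> \bar R}) (x : R[i]).

(* The measure [|z - x|^2 dmu(z)]. *)
Definition nux (A : set (borelC R)) : \bar R :=
  (\int[mu]_(z in A) (normc (z - x) ^+ 2)%:E)%E.

Let normc2_measurable :
  measurable_fun setT (fun z : borelC R => normc (z - x) ^+ 2).
Proof.
apply: (measurability _ (RGenOpens.measurableE R)).
move=> _ [_ [a [b ->] <-]]; rewrite setTI; apply: sub_sigma_algebra.
have /continuousP cf : continuous (fun z : R[i] => normc (z - x) ^+ 2).
  move=> z; apply: (@continuous_comp _ _ _ (fun w : R[i] => normc (w - x))
    (fun r : R => r ^+ 2)); first exact: normc_sub_continuous.
  exact: exprn_continuous.
exact/cf/interval_open.
Qed.

Let nux0 : nux set0 = 0%E.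
Proof. exact: integral_set0. Qed.

Let nux_ge0 A : (0 <= nux A)%E.
Proof. by apply: integral_ge0 => z _; rewrite lee_fin sqr_ge0. Qed.

Let nux_sigma_additive : semi_sigma_additive nux.
Proof.
apply: semi_sigma_additive_nng_induced => [|z]; last by rewrite lee_fin sqr_ge0.
by apply/measurable_EFinP; exact: normc2_measurable.
Qed.

HB.instance Definition _ :=
  isMeasure.Build _ (borelC R) R nux nux0 nux_ge0 nux_sigma_additive.

End christoffel_transform.

End measures_on_the_plane.

(* For [P] and [Q] of the same degree, the value at infinity is the limit of
   [P.[z] / Q.[z]] as [z] tends to infinity. *)
Definition sphere_ratio (R : realType) (P Q : {poly R[i]})
    (w : riemann_sphere R) : R[i] :=
  if w is Some z then P.[z] / Q.[z] else lead_coef P / lead_coef Q.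

(* Main.v *)
Require Import Defs.
From mathcomp Require Import all_boot all_order all_algebra.
From mathcomp Require Import complex ring lra.
From mathcomp Require Import all_classical all_reals all_analysis.
From mathcomp Require Import measurable_realfun.

Set Implicit Arguments.
Unset Strict Implicit.
Unset Printing Implicit Defensive.

Import Order.TTheory GRing.Theory Num.Theory.
Import numFieldNormedType.Exports.

Local Open Scope classical_set_scope.
Local Open Scope ring_scope.

(** Let K be the reproducing kernel of degree < n at x and k = K(x).  The
    polynomial p_n - (p_n(x) / k) K vanishes at x and is orthogonal to the
    polynomials of degree < n vanishing at x, so it is a multiple of
    (z - x) q_{n-1}, where q is orthonormal for nu^x; its squared norm is 1 + eps_n
    with eps_n = |p_n(x)|^2 / k.  Hence
      (z - x) q_{n-1}(z) / p_n(z)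
        = (1 + eps_n)^(-1/2) (1 - p_n(x) K(z) / (k p_n(z))).
    If a line separates z from the support, at distance >= d from z, and the
    support lies in the disc of radius D about z, then
    |Q(z)| <= (D / d) |p_n(z)| ||Q|| for deg Q < n; with Q = K the last term is at
    most (D / d) sqrt(eps_n).  The ratio D / d is locally bounded off the convex
    hull, and at most 3 near infinity. *)

(** * Orthonormal polynomials of an inner product *)

(** The algebra is done for an abstract form on polynomials. There [nu^x] enters only as the form
    <(X - x) P, (X - x) Q>, and the position of z relative to the support enters only through two
    inequalities: d <P, P> <= |<P, (X - z) P>| and |(X - z) P|^2 <= D^2 |P|^2. Measure theory is
    confined to checking that a measure provides such a form and these inequalities. No asymptotics
    of p_n(z) are available, so the kernel has to be compared with p_n(z) itself at the same point;
    this is why the estimate of Q(z) carries the factor |p_n(z)|. Since eps_n does not depend on z,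
    uniformity reduces to local bounds on D / d. A bound valid for all n at once near each point of
    the sphere, infinity included, is turned into a bound on K by compactness. Positivity of both
    leading coefficients removes the phase ambiguity: the multiple of (z - x) q_{n-1} is positive,
    so the limit is 1 and not merely unimodular. *)

Section triangular_basis.
Variables (F : fieldType) (p : nat -> {poly F}).

Lemma triangular_span n : (forall j, (j < n)%N -> size (p j) = j.+1) ->
  forall Q : {poly F}, (size Q <= n)%N ->
  exists c : nat -> F, Q = \sum_(j < n) c j *: p j.
Proof.
elim: n => [|n IHn] sp Q.
  by rewrite leqn0 size_poly_eq0 => /eqP ->; exists (fun=> 0); rewrite big_ord0.
move=> sQ; set a := Q`_n / (p n)`_n.
have pn0 : (p n)`_n != 0.
  have := sp n (ltnSn n); rewrite -[_`_n]/((p n)`_(n.+1.-1)) => <-.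
  by rewrite -/(lead_coef _) lead_coef_eq0 -size_poly_eq0 sp.
have [j jn|/= |c Qc] := IHn _ (Q - a *: p n).
- by apply: sp; rewrite ltnS ltnW.
- apply/leq_sizeP => j; rewrite leq_eqVlt => /predU1P[<-|nj].
    by rewrite coefB coefZ divfK// subrr.
  rewrite coefB coefZ !nth_default ?mulr0 ?subrr//.
    by rewrite sp.
  exact: leq_trans sQ _.
exists (fun j => if (j == n)%N then a else c j).
rewrite big_ord_recr/= eqxx -[LHS](subrK (a *: p n)) Qc; congr (_ + _).
by apply: eq_bigr => i _; rewrite ltn_eqF.
Qed.

End triangular_basis.

Section inner_products.
Variable C : numClosedFieldType.
Implicit Types (B : {poly C} -> {poly C} -> C) (P Q S : {poly C}).

Definition inner_product B : Prop :=
  [/\ forall a P Q S, B P (a *: Q + S) = a * B P Q + B P S,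
      forall P Q, B Q P = (B P Q)^* &
      forall P, P != 0 -> 0 < B P P].

Definition orthonormal_for B (p : nat -> {poly C}) : Prop :=
  [/\ forall n, size (p n) = n.+1,
      forall n, 0 < lead_coef (p n) &
      forall n m, B (p n) (p m) = (n == m)%:R].

Section theory.
Variable B : {poly C} -> {poly C} -> C.
Hypothesis ipB : inner_product B.

Lemma ipC P Q : B Q P = (B P Q)^*.
Proof. by have [] := ipB. Qed.

Lemma ip_gt0 P : P != 0 -> 0 < B P P.
Proof. by have [_ _] := ipB; apply. Qed.

Lemma ip0r P : B P 0 = 0.
Proof.
have [BL _ _] := ipB; have := BL 1 P 0 0; rewrite scaler0 addr0 mul1r => h.
by apply: (addrI (B P 0)); rewrite addr0 -h.
Qed.

Lemma ip_ge0 P : 0 <= B P P.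
Proof. by have [->|/ip_gt0/ltW//] := eqVneq P 0; rewrite ip0r. Qed.

Lemma ipDr P Q S : B P (Q + S) = B P Q + B P S.
Proof. by have [BL _ _] := ipB; have := BL 1 P Q S; rewrite scale1r mul1r. Qed.

Lemma ipZr P a Q : B P (a *: Q) = a * B P Q.
Proof. by have [BL _ _] := ipB; have := BL a P Q 0; rewrite ip0r !addr0. Qed.

Lemma ipBr P Q S : B P (Q - S) = B P Q - B P S.
Proof. by rewrite ipDr -scaleN1r ipZr mulN1r. Qed.

Lemma ip_sumr P n (f : nat -> {poly C}) :
  B P (\sum_(j < n) f j) = \sum_(j < n) B P (f j).
Proof.
elim: n => [|n IHn]; first by rewrite !big_ord0 ip0r.
by rewrite !big_ord_recr/= ipDr IHn.
Qed.

Lemma ipZl P a Q : B (a *: Q) P = a^* * B Q P.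
Proof. by rewrite ipC ipZr rmorphM/= -ipC. Qed.

Lemma ipBl P Q S : B (Q - S) P = B Q P - B S P.
Proof. by rewrite ipC ipBr rmorphB/= -!ipC. Qed.

(** The vector <P,P> Q - <P,Q> P has squared norm <P,P> (<P,P> <Q,Q> - |<P,Q>|^2), a form of the
    usual argument that needs no division. *)
Lemma ip_cauchy_schwarz P Q : `|B P Q| ^+ 2 <= B P P * B Q Q.
Proof.
have [->|P0] := eqVneq P 0.
  by rewrite ip0r mul0r ipC ip0r rmorph0 normr0 expr0n.
have BP := ip_gt0 P0; have BPc : (B P P)^* = B P P by rewrite -ipC.
have := ip_ge0 (B P P *: Q - B P Q *: P).
rewrite ipBl !ipBr !ipZl !ipZr BPc (ipC P Q) normCK => h.
rewrite -subr_ge0 -(pmulr_rge0 _ BP).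
by apply: le_trans h _; rewrite le_eqVlt; apply/orP; left; apply/eqP; ring.
Qed.

(** One Gram-Schmidt step applied to X^n. Both hypotheses concern indices below [n] only, so the
    step can feed the induction that builds the sequence. *)
Lemma orthogonal_monomial n (p : nat -> {poly C}) :
  (forall j, (j < n)%N -> size (p j) = j.+1) ->
  (forall i j, (i < n)%N -> (j < n)%N -> B (p i) (p j) = (i == j)%:R) ->
  exists P, [/\ size P = n.+1, 0 < lead_coef P, B P P = 1 &
    forall Q, (size Q <= n)%N -> B Q P = 0].
Proof.
move=> sp op; pose M := 'X^n - \sum_(j < n) B (p j) 'X^n *: p j.
have sS : (size (\sum_(j < n) B (p j) 'X^n *: p j)%R <= n)%N.
  apply: (leq_trans (size_sum _ _ _)); apply/bigmax_leqP => j _.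
  by apply: (leq_trans (size_scale_leq _ _)); rewrite sp.
have sM : size M = n.+1 by rewrite size_polyDl ?size_polyXn// size_polyN ltnS.
have lM : lead_coef M = 1.
  by rewrite lead_coefDl ?lead_coefXn// size_polyXn size_polyN ltnS.
have M0 : M != 0 by rewrite -size_poly_eq0 sM.
have BM := ip_gt0 M0.
have ortho Q : (size Q <= n)%N -> B Q M = 0.
  move=> /(triangular_span sp)[c ->].
  rewrite (ipC M) (ip_sumr _ _ (fun j => c j *: p j)) big1 ?rmorph0// => j _.
  rewrite ipZr ipC /M ipBr (ip_sumr _ _ (fun j => B (p j) 'X^n *: p j)).
  rewrite (bigD1 j)//= ipZr op// eqxx mulr1 big1 ?addr0 ?subrr ?rmorph0 ?mulr0//.
  move=> i ij; rewrite ipZr op// (_ : (j == i :> nat) = false) ?mulr0//.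
  by rewrite eq_sym; exact: negbTE.
pose s := sqrtC (B M M).
have s0 : 0 < s by rewrite sqrtC_gt0.
exists (s^-1 *: M); split.
- by rewrite size_scale// invr_eq0 gt_eqF.
- by rewrite lead_coefZ lM mulr1 invr_gt0.
- rewrite ipZl ipZr (CrealP _) ?mulrA; last by rewrite realV gtr0_real.
  by rewrite -invfM -expr2 sqrtCK mulVf// gt_eqF.
- by move=> Q sQ; rewrite ipZr ortho ?mulr0.
Qed.

Lemma orthonormal_for_exists : exists p, orthonormal_for B p.
Proof.
have step n : exists P, [/\ size P = n.+1, 0 < lead_coef P, B P P = 1 &
    forall Q, (size Q <= n)%N -> B Q P = 0].
  elim/ltn_ind: n => n IHn.
  (* Orthogonality to every polynomial of lower degree makes independently chosen [p j] mutually
     orthogonal, so the induction need not carry one coherent sequence. For [j >= n] the requirement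
     is vacuous. *)
  have /choice[p pP] j : exists P, (j < n)%N -> [/\ size P = j.+1,
      0 < lead_coef P, B P P = 1 & forall Q, (size Q <= j)%N -> B Q P = 0].
    by have [/IHn[P ?]|] := ltnP j n; [exists P | exists 0].
  apply: (orthogonal_monomial (p := p)) => [j /pP[]//|i j ni nj].
  have [si _ pi oi] := pP _ ni; have [sj _ pj oj] := pP _ nj.
  case: ltngtP => [ij|ji|->]//.
  - by rewrite oj// si.
  - by rewrite ipC oi ?rmorph0// sj.
have [p pP] := choice step.
exists p; split=> [n|n|n m]; [by case: (pP n)|by case: (pP n)|].
have [sn _ pn on] := pP n; have [sm _ pm om] := pP m.
case: ltngtP => [nm|mn|<-]//; first by rewrite om// sn.
by rewrite ipC on ?rmorph0// sm.
Qed.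

Lemma ip_orthonormal_lt p n Q : orthonormal_for B p -> (size Q <= n)%N ->
  B (p n) Q = 0.
Proof.
move=> [sp _ op] /(triangular_span (fun j _ => sp j))[c ->].
rewrite (ip_sumr _ _ (fun j => c j *: p j)) big1// => j _.
by rewrite ipZr op gtn_eqF ?mulr0.
Qed.

(** The Christoffel-Darboux kernel with one variable frozen at [x]. The conjugate sits on the
    coefficient because the form is conjugate-linear in its first slot, where the kernel is
    placed. *)
Definition reproducing_kernel (p : nat -> {poly C}) n x :=
  \sum_(j < n) ((p j).[x])^* *: p j.

Section orthonormal.
Variable p : nat -> {poly C}.
Hypothesis op : orthonormal_for B p.

Lemma ip_reproducing_kernel n x Q : (size Q <= n)%N ->
  B (reproducing_kernel p n x) Q = Q.[x].
Proof.
have [sp _ pp] := op => /(triangular_span (fun j _ => sp j))[c ->].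
rewrite ipC (ip_sumr _ _ (fun j => ((p j).[x])^* *: p j)) rmorph_sum horner_sum.
apply: eq_bigr => /= j _; rewrite ipZr rmorphM/= conjCK -ipC hornerZ mulrC.
congr (_ * _); rewrite (ip_sumr _ _ (fun j => c j *: p j)) (bigD1 j)//=.
rewrite ipZr pp eqxx mulr1 big1 ?addr0// => i ij.
by rewrite ipZr pp (_ : (j == i :> nat) = false) ?mulr0// eq_sym; exact: negbTE.
Qed.

Lemma size_reproducing_kernel n x : (size (reproducing_kernel p n x) <= n)%N.
Proof.
have [sp _ _] := op.
apply: (leq_trans (size_sum _ _ _)); apply/bigmax_leqP => j _.
by apply: (leq_trans (size_scale_leq _ _)); rewrite sp.
Qed.

Lemma horner_reproducing_kernel n x :
  (reproducing_kernel p n x).[x] = \sum_(j < n) `|(p j).[x]| ^+ 2.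
Proof.
rewrite horner_sum; apply: eq_bigr => j _.
by rewrite hornerZ normCK mulrC.
Qed.

Lemma sum_orthonormal_gt0 n x : (0 < n)%N ->
  0 < \sum_(j < n) `|(p j).[x]| ^+ 2.
Proof.
case: n => // n _; have [sp lp _] := op.
have p0x : (p 0).[x] != 0.
  have := lp 0; have /eqP/size_poly1P[c c0 ->] := sp 0.
  by rewrite hornerC.
rewrite big_ord_recl ltr_pwDl ?exprn_gt0 ?normr_gt0//.
by apply: sumr_ge0 => j _; exact: exprn_ge0.
Qed.

(* With [R = (Q p_n(z) - Q(z) p_n) / (X - z)], orthogonality of [p_n] to
   [R] and [Q] gives [<R, (X - z) R> = p_n(z) <R, Q>] and
   [|(X - z) R|^2 >= |Q(z)|^2]. *)
Lemma orthonormal_eval_bound n z d D Q : 0 < d ->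
  (forall P, d * B P P <= `|B P (('X - z%:P) * P)|) ->
  (forall P, B (('X - z%:P) * P) (('X - z%:P) * P) <= D ^+ 2 * B P P) ->
  0 <= D -> (size Q <= n)%N ->
  d ^+ 2 * `|Q.[z]| ^+ 2 <= D ^+ 2 * (`|(p n).[z]| ^+ 2 * B Q Q).
Proof.
move=> d0 hd hD D0 sQ; have [sp lp pp] := op.
pose N := (p n).[z] *: Q - Q.[z] *: p n.
have /factor_theorem[S NE] : root N z.
  by rewrite /root /N hornerD hornerN !hornerZ mulrC subrr.
have sN : (size N <= n.+1)%N.
  apply: (leq_trans (size_polyD _ _)); rewrite geq_max size_polyN.
  rewrite (leq_trans (size_scale_leq _ _)) ?(leq_trans sQ)//.
  by rewrite (leq_trans (size_scale_leq _ _)) ?sp.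
have sS : (size S <= n)%N.
  have [->|S0] := eqVneq S 0; first by rewrite size_poly0.
  by move: sN; rewrite NE size_Mmonic ?monicXsubC// size_XsubC addn2.
rewrite mulrC in NE.
have BSp : B S (p n) = 0.
  by rewrite ipC (ip_orthonormal_lt op)// rmorph0.
have BQp : B Q (p n) = 0.
  by rewrite ipC (ip_orthonormal_lt op)// rmorph0.
have BSN : B S (('X - z%:P) * S) = (p n).[z] * B S Q.
  by rewrite -NE ipBr !ipZr BSp mulr0 subr0.
have BNN : B N N = `|(p n).[z]| ^+ 2 * B Q Q + `|Q.[z]| ^+ 2.
  rewrite /N ipBr !ipBl !ipZr !ipZl BQp (ip_orthonormal_lt op)// pp eqxx mulr1n !normCK.
  ring.
(* Squaring d <S,S> <= |p_n(z)| |<S,Q>| and applying Cauchy-Schwarz leaves a common factor <S,S>,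
   which cancels when [S] is nonzero. *)
have hS : d ^+ 2 * B S S <= `|(p n).[z]| ^+ 2 * B Q Q.
  have [->|S0] := eqVneq S 0.
    by rewrite ip0r mulr0 mulr_ge0 ?exprn_ge0 ?ip_ge0.
  rewrite -(ler_pM2r (ip_gt0 S0)) -mulrA -expr2 -exprMn.
  apply: (@le_trans _ _ (`|B S (('X - z%:P) * S)| ^+ 2)).
    rewrite ler_pXn2r ?nnegrE ?hd// mulr_ge0 ?ip_ge0// ltW//.
  rewrite BSN normrM exprMn -[leRHS]mulrA ler_wpM2l ?exprn_ge0//.
  by rewrite mulrC ip_cauchy_schwarz.
apply: (@le_trans _ _ (d ^+ 2 * (D ^+ 2 * B S S))).
  rewrite ler_pM2l ?exprn_gt0//; apply: le_trans (hD S).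
  by rewrite -NE BNN lerDr mulr_ge0 ?exprn_ge0 ?ip_ge0.
by rewrite mulrCA ler_wpM2l// exprn_ge0.
Qed.

(** Fejér's argument: at a zero z, p_n = (X - z) S with S of lower degree, so <S, (X - z) S> = <S,
    p_n> = 0, against the lower bound d <S,S> > 0. *)
Lemma orthonormal_neq0 n z d : 0 < d ->
  (forall P, d * B P P <= `|B P (('X - z%:P) * P)|) -> (p n).[z] != 0.
Proof.
move=> d0 hd; have [sp lp pp] := op; apply/eqP => pz.
have /factor_theorem[S pE] : root (p n) z by apply/eqP.
have pn0 : p n != 0 by rewrite -size_poly_eq0 sp.
have S0 : S != 0 by apply: contraNneq pn0 => S0; rewrite pE S0 mul0r.
have sS : (size S <= n)%N.
  by have := sp n; rewrite pE size_Mmonic ?monicXsubC// size_XsubC addn2 => -[->].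
have := hd S; rewrite mulrC [_ * S]mulrC -pE [X in `|X|]ipC.
rewrite (ip_orthonormal_lt op)// rmorph0.
by rewrite normr0 => /(lt_le_trans (mulr_gt0 (ip_gt0 S0) d0)); rewrite ltxx.
Qed.

End orthonormal.

(** * The Christoffel transform of an inner product *)

Section christoffel.
Variables (p q : nat -> {poly C}) (x : C).
Hypothesis op : orthonormal_for B p.
Hypothesis oq :
  orthonormal_for (fun P Q => B (('X - x%:P) * P) (('X - x%:P) * Q)) q.

Let k n := \sum_(j < n) `|(p j).[x]| ^+ 2.

Lemma christoffel_formula n : (0 < n)%N ->
  exists l : C, [/\ 1 <= l, l ^+ 2 = 1 + `|(p n).[x]| ^+ 2 / k n &
    l *: (('X - x%:P) * q n.-1) =
    p n - ((p n).[x] / k n) *: reproducing_kernel p n x].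
Proof.
move=> n0; have [sp lp pp] := op; have [sq lq qq] := oq.
have k0 : 0 < k n by exact: sum_orthonormal_gt0.
have kn0 : k n != 0 by rewrite gt_eqF.
set K := reproducing_kernel p n x; set G := p n - _.
have sK : (size K <= n)%N by exact: size_reproducing_kernel.
have sK' a : (size (a *: K) <= n)%N by exact: leq_trans (size_scale_leq _ _) _.
have sG : size G = n.+1.
  by rewrite size_polyDl ?size_polyN sp ?ltnS.
have lG : lead_coef G = lead_coef (p n).
  by rewrite /G lead_coefDl// size_polyN sp ltnS.
have Gx : G.[x] = 0.
  by rewrite /G hornerD hornerN hornerZ horner_reproducing_kernel divfK// subrr.
have BKG Q : (size Q <= n)%N -> Q.[x] = 0 -> B Q G = 0.
  move=> sQ Qx; rewrite ipBr ipZr ipC (ip_orthonormal_lt op)// rmorph0.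
  by rewrite ipC ip_reproducing_kernel// Qx rmorph0 mulr0 subrr.
have BGG : B G G = 1 + `|(p n).[x]| ^+ 2 / k n.
  have BKp : B K (p n) = 0 by rewrite ipC (ip_orthonormal_lt op)// rmorph0.
  have BKK : B K K = k n by rewrite ip_reproducing_kernel// horner_reproducing_kernel.
  have kc : (k n)^* = k n by rewrite -BKK -ipC.
  rewrite /G ipBl !ipBr !ipZl !ipZr pp eqxx mulr1n BKp (ip_orthonormal_lt op)//.
  have -> : ((p n).[x] / k n)^* = (p n).[x]^* / k n.
    by rewrite -[in RHS]kc -fmorphV -rmorphM.
  by rewrite BKK normCK; field.
have /factor_theorem[g gE] : root G x by apply/eqP.
rewrite mulrC in gE.
have g0 : g != 0.
  by apply/eqP => g0; move: sG; rewrite gE g0 mulr0 size_poly0.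
have sg : size g = n.
  by move: sG; rewrite gE mulrC size_Mmonic ?monicXsubC// size_XsubC addn2 => -[].
have Xx0 : ('X - x%:P) != 0 by rewrite polyXsubC_eq0.
set r := q n.-1; have sr : size r = n by rewrite sq prednK.
have lgp : lead_coef g = lead_coef (p n).
  by rewrite -lG gE mulrC lead_coef_Mmonic ?monicXsubC.
set l := lead_coef g / lead_coef r.
have l0 : 0 < l by apply: divr_gt0; [rewrite lgp; exact: lp | exact: lq].
(* By the choice of [l] the leading terms cancel and [h] has degree below n - 1, so (X - x) h is
   orthogonal to (X - x) q_{n-1}. It has degree below n and vanishes at x, so it is also orthogonal
   to [G]. Being G - l (X - x) q_{n-1}, it is orthogonal to itself, hence zero. *)
have gr : g = l *: r.
  pose h := g - l *: r; apply/eqP; rewrite -subr_eq0 -/h.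
  have sh : (size h <= n.-1)%N.
    apply/leq_sizeP => i; rewrite leq_eqVlt => /predU1P[<-|ni].
      have -> : h`_n.-1 = lead_coef g - l * lead_coef r.
        by rewrite coefB coefZ !lead_coefE sg sr.
      rewrite divfK ?subrr//.
      by rewrite lead_coef_eq0 -size_poly_eq0 sr -lt0n.
    rewrite coefB coefZ !nth_default ?mulr0 ?subrr ?sg ?sr//.
      by rewrite -(prednK n0).
    by rewrite -(prednK n0).
  apply/negPn/negP => h0.
  have hr : B (('X - x%:P) * r) (('X - x%:P) * h) = 0.
    have [c ->] := triangular_span (fun j _ => sq j) sh.
    rewrite mulr_sumr (ip_sumr _ _ (fun j => ('X - x%:P) * (c j *: q j))).
    rewrite big1// => j _.
    by rewrite -scalerAr ipZr qq gtn_eqF ?mulr0.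
  have := ip_gt0 (mulf_neq0 Xx0 h0).
  have hE : ('X - x%:P) * h = G - l *: (('X - x%:P) * r).
    by rewrite mulrBr -gE -scalerAr.
  rewrite {2}hE ipBr ipZr (ipC (('X - x%:P) * r)) hr rmorph0 mulr0 subr0.
  rewrite BKG ?ltxx// ?hornerM ?hornerXsubC ?subrr ?mul0r//.
  rewrite mulrC size_Mmonic ?monicXsubC//.
  by rewrite size_XsubC addn2/= -(prednK n0).
have lE : l ^+ 2 = 1 + `|(p n).[x]| ^+ 2 / k n.
  rewrite -BGG gE gr -!scalerAr ipZl ipZr qq eqxx mulr1n mulr1.
  by rewrite (CrealP _) ?gtr0_real// expr2.
exists l; split=> //; last by rewrite scalerAr -gr gE.
rewrite -(@ler_pXn2r _ 2)// ?nnegrE ?ler01 ?(ltW l0)// expr1n lE lerDl.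
by rewrite divr_ge0 ?exprn_ge0// ltW.
Qed.

Let eps n := `|(p n).[x]| ^+ 2 / k n.

Let eps_ge0 n : 0 <= eps n.
Proof. by rewrite divr_ge0 ?exprn_ge0// sumr_ge0// => j _; rewrite exprn_ge0. Qed.

(** Here eps = (l - 1)(l + 1), so 1 - 1/l = eps / (l (l + 1)), and l (l + 1) >= 1. *)
Let inv_l_bound n (l : C) : 1 <= l -> l ^+ 2 = 1 + eps n -> `|l^-1 - 1| <= eps n.
Proof.
move=> l1 lE; have l0 : 0 < l by exact: lt_le_trans l1.
have li1 : l^-1 <= 1 by rewrite invf_le1.
rewrite distrC ger0_norm ?subr_ge0//.
rewrite -(ler_pM2r l0) mulrBl mul1r mulVf ?gt_eqF//.
have -> : eps n = (l - 1) * (l + 1) by rewrite -subr_sqr lE expr1n addrC addKr.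
rewrite -mulrA ler_peMr ?subr_ge0//.
by rewrite mulr_ege1// ler_wpDr.
Qed.

(** The estimate at infinity. The kernel has degree below n and does not reach the leading
    coefficient, so the ratio is exactly 1/l and no term in D / d appears. *)
Lemma christoffel_lead_ratio n : (0 < n)%N ->
  `|lead_coef (('X - x%:P) * q n.-1) / lead_coef (p n) - 1| <=
  `|(p n).[x]| ^+ 2 / \sum_(j < n) `|(p j).[x]| ^+ 2.
Proof.
move=> n0; have [sp lp _] := op.
have [l [l1 lE /(congr1 lead_coef)]] := christoffel_formula n0.
rewrite lead_coefZ lead_coefDl; last first.
  rewrite size_polyN sp ltnS (leq_trans (size_scale_leq _ _))//.
  exact: size_reproducing_kernel.
move=> <-; rewrite invfM mulrCA divff ?mulr1; first exact: inv_l_bound.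
by rewrite lead_coefM lead_coefXsubC mul1r gt_eqF//; case: oq.
Qed.

Lemma christoffel_ratio n z d D : (0 < n)%N -> 0 < d -> 0 <= D ->
  (forall P, d * B P P <= `|B P (('X - z%:P) * P)|) ->
  (forall P, B (('X - z%:P) * P) (('X - z%:P) * P) <= D ^+ 2 * B P P) ->
  let e := `|(p n).[x]| ^+ 2 / \sum_(j < n) `|(p j).[x]| ^+ 2 in
  `|(('X - x%:P) * q n.-1).[z] / (p n).[z] - 1| <= e + D / d * sqrtC e.
Proof.
move=> n0 d0 D0 hd hD; rewrite -/(k n) -/(eps n) /=.
have pz : (p n).[z] != 0 by exact: (orthonormal_neq0 op _ d0 hd).
have k0 : 0 < k n by exact: sum_orthonormal_gt0.
have [l [l1 lE /(congr1 (horner^~ z))]] := christoffel_formula n0.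
have l0 : 0 < l by exact: lt_le_trans l1.
rewrite hornerZ hornerD hornerN (hornerZ _ (reproducing_kernel _ _ _)).
set K := reproducing_kernel p n x; set b := (p n).[x] / k n => formula.
have -> : (('X - x%:P) * q n.-1).[z] / (p n).[z] - 1 =
    (l^-1 - 1) - l^-1 * (b * K.[z] / (p n).[z]).
  apply: (mulfI (_ : l != 0)); first by rewrite gt_eqF.
  rewrite mulrBr mulrA formula mulr1 mulrBr mulrBr mulrA mulfV ?gt_eqF//.
  by rewrite mulrBl divff// mul1r mulr1; ring.
apply: (le_trans (ler_normB _ _)); apply: lerD; first exact: inv_l_bound.
rewrite normrM ger0_norm ?invr_ge0 ?(ltW l0)//.
apply: (@le_trans _ _ `|b * K.[z] / (p n).[z]|).
  by rewrite ler_piMl// invf_le1.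
(* Squares are compared because the evaluation bound is quadratic. At Q = K it carries the factor
   <K,K> = K(x) = k, which |b|^2 = eps_n / k cancels. *)
rewrite -(@ler_pXn2r _ 2)// ?nnegrE ?mulr_ge0 ?invr_ge0 ?(ltW d0) ?sqrtC_ge0//.
rewrite 2!normrM normfV !exprMn !exprVn sqrtCK.
rewrite ler_pdivrMr ?exprn_gt0 ?normr_gt0//.
have := orthonormal_eval_bound op d0 hd hD D0 (size_reproducing_kernel op n x).
rewrite ip_reproducing_kernel ?size_reproducing_kernel// horner_reproducing_kernel.
rewrite -/K -/(k n) => bound.
have -> : `|b| ^+ 2 = eps n / k n.
  by rewrite normrM normfV (ger0_norm (ltW k0)) exprMn /eps; field; rewrite gt_eqF.
have -> : D ^+ 2 / d ^+ 2 * eps n * `|(p n).[z]| ^+ 2 =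
    (eps n / k n) * ((D ^+ 2 * (`|(p n).[z]| ^+ 2 * k n)) / d ^+ 2).
  by field; rewrite !gt_eqF.
rewrite ler_wpM2l ?mulr_ge0 ?invr_ge0 ?(ltW k0)//.
by rewrite ler_pdivlMr ?exprn_gt0// mulrC.
Qed.

End christoffel.
End theory.
End inner_products.

(** * Integration of continuous functions over the support *)

Section integral_density.
Context d (T : measurableType d) (R : realType).
Variables (mu nu : {measure set T -> \bar R}) (h : T -> R).
Hypothesis h0 : forall x, 0 <= h x.
Hypothesis mh : measurable_fun setT h.
Hypothesis nuE : forall A, measurable A -> nu A = (\int[mu]_(x in A) (h x)%:E)%E.

Let mhE : measurable_fun setT (EFin \o h).
Proof. exact/measurable_EFinP. Qed.

Import HBNNSimple.

Let integral_density_nnsfun (f : {nnsfun T >-> R}) :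
  (\int[nu]_x (f x)%:E = \int[mu]_x ((f x)%:E * (h x)%:E))%E.
Proof.
rewrite integralT_nnsfun sintegralE.
transitivity (\int[mu]_x (\sum_(r \in range f)
    ((r * \1_(f @^-1` [set r]) x)%:E * (h x)%:E)))%E; last first.
  apply: eq_integral => x _.
  rewrite -ge0_mule_fsuml => [|r]; last exact: nnfun_muleindic_ge0.
  by rewrite fsumEFin// -(fimfunE f x).
rewrite ge0_integral_fsum//; last 2 first.
- move=> r; apply: emeasurable_funM => //.
  by apply/measurable_EFinP; exact: measurable_funM.
- by move=> r x _; apply: mule_ge0; [exact: nnfun_muleindic_ge0|rewrite lee_fin].
apply: eq_fsbigr => r; rewrite inE => -[t _ <-].
rewrite nuE//; under [RHS]eq_integral do rewrite EFinM -muleA.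
rewrite ge0_integralZl//.
- congr (_ * _)%E; rewrite integral_mkcond; apply: eq_integral => x _.
  by rewrite /= muleC epatch_indic.
- by apply: emeasurable_funM => //; exact/measurable_EFinP.
- by move=> x _; rewrite mule_ge0 ?lee_fin.
- by rewrite lee_fin.
Qed.

(** Linearity gives the identity for simple functions; monotone convergence along an increasing
    simple approximation of [f] does the rest. *)
Lemma ge0_integral_density (f : T -> \bar R) : measurable_fun setT f ->
  (forall x, (0 <= f x)%E) ->
  (\int[nu]_x f x = \int[mu]_x (f x * (h x)%:E))%E.
Proof.
move=> mf f0; pose g := nnsfun_approx measurableT mf.
transitivity (limn (fun n => \int[nu]_x (g n x)%:E)%E).
  rewrite -monotone_convergence//.
  - apply: eq_integral => x _; apply/esym/cvg_lim => //.
    exact: cvg_nnsfun_approx.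
  - by move=> n; exact/measurable_EFinP.
  - by move=> n x _; rewrite lee_fin.
  - by move=> x _ a b ab; rewrite lee_fin; exact/lefP/nd_nnsfun_approx.
under eq_fun do rewrite integral_density_nnsfun.
rewrite -monotone_convergence//.
- apply: eq_integral => x _; apply/cvg_lim => //.
  by apply: cvgeZr => //; exact: cvg_nnsfun_approx.
- by move=> n; apply: emeasurable_funM => //; exact/measurable_EFinP.
- by move=> n x _; rewrite mule_ge0 ?lee_fin.
- move=> x _ a b ab; rewrite lee_wpmul2r ?lee_fin//.
  exact/lefP/nd_nnsfun_approx.
Qed.

(** As [h] is nonnegative, multiplication by [h] commutes with taking positive and negative parts,
    so the nonnegative case applies to each part. *)
Lemma Rintegral_density (f : T -> R) : measurable_fun setT f ->
  \int[nu]_x f x = \int[mu]_x (f x * h x).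
Proof.
move=> /measurable_EFinP mf; rewrite /Rintegral [in LHS]integralE [in RHS]integralE.
congr (fine (_ - _)).
- rewrite ge0_integral_density//; last exact: measurable_funepos.
  apply: eq_integral => x _; rewrite !funeposE -!EFin_max -EFinM.
  by congr (_%:E); rewrite maxr_pMl// mul0r.
- rewrite ge0_integral_density//; last exact: measurable_funeneg.
  apply: eq_integral => x _; rewrite !funenegE/= -!EFin_max -EFinM.
  by congr (_%:E); rewrite maxr_pMl// mul0r mulNr.
Qed.

End integral_density.

Lemma numField_continuous_horner (K : numFieldType) (P : {poly K}) :
  continuous (horner P : K -> K).
Proof.
elim/poly_ind: P => [|P c IHP] z.
  rewrite (_ : horner 0 = cst 0); first exact: cst_continuous.
  by apply/funext => w; rewrite horner0.
rewrite (_ : horner _ = (horner P \* id) \+ cst c); last first.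
  by apply/funext => w; rewrite hornerMXaddC.
apply: continuousD; last exact: cst_continuous.
by apply: continuousM; [exact: IHP|exact: cvg_id].
Qed.

Section complex_plane.
Variable R : realType.
Implicit Types (z w : R[i]).
Local Open Scope complex_scope.

Lemma normC_normc z : `|z| = (normc z)%:C.
Proof. by []. Qed.

Lemma normc_ge0 z : 0 <= normc z.
Proof. by rewrite -ler0c -normC_normc normr_ge0. Qed.

Lemma normc_sqr z : normc z ^+ 2 = complex.Re z ^+ 2 + complex.Im z ^+ 2.
Proof. by case: z => a b; rewrite /normc sqr_sqrtr// addr_ge0// sqr_ge0. Qed.

Lemma normc_ge_abs_Re z : `|complex.Re z| <= normc z.
Proof. by have := normc_ge_Re z; rewrite normC_normc lecR. Qed.

Lemma normc_ge_abs_Im z : `|complex.Im z| <= normc z.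
Proof.
rewrite -(@ler_pXn2r _ 2)// ?nnegrE ?normc_ge0//.
by rewrite real_normK ?num_real// normc_sqr lerDr sqr_ge0.
Qed.

Lemma normc_le_ReIm z : normc z <= `|complex.Re z| + `|complex.Im z|.
Proof.
rewrite -(@ler_pXn2r _ 2)// ?nnegrE ?normc_ge0 ?addr_ge0//.
rewrite normc_sqr sqrrD !real_normK ?num_real// addrAC lerDl mulrn_wge0//.
Qed.

Lemma Re_continuous : continuous (@complex.Re R : R[i] -> R).
Proof.
move=> z; apply/(@cvgrPdist_lt _ _ _ (nbhs z)) => e e0.
exists e%:C => /= [|w zw]; first by rewrite ltcR.
rewrite -ltcR; apply: le_lt_trans zw; rewrite -raddfB /=.
by rewrite normC_normc lecR normc_ge_abs_Re.
Qed.

Lemma Im_continuous : continuous (@complex.Im R : R[i] -> R).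
Proof.
move=> z; apply/(@cvgrPdist_lt _ _ _ (nbhs z)) => e e0.
exists e%:C => /= [|w zw]; first by rewrite ltcR.
rewrite -ltcR; apply: le_lt_trans zw; rewrite -raddfB /=.
by rewrite normC_normc lecR normc_ge_abs_Im.
Qed.

Lemma conjc_continuous : continuous (@conjc R : R[i] -> R[i]).
Proof.
move=> z; apply/(@cvgrPdist_lt _ _ _ (nbhs z)) => e e0.
exists e => //= w zw.
by rewrite -rmorphB /= normcJ.
Qed.

Lemma horner_continuous (P : {poly R[i]}) : continuous (horner P : R[i] -> R[i]).
Proof. exact: (@numField_continuous_horner R[i]). Qed.

End complex_plane.

(** * The closed support and its null complement *)

Section support.
Variable R : realType.
Local Open Scope complex_scope.

Lemma open_borelC (U : set R[i]) : open U -> measurable (U : set (borelC R)).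
Proof. exact: sub_sigma_algebra. Qed.

Lemma continuous_borelC (f : R[i] -> R) : continuous f ->
  measurable_fun setT (f : borelC R -> R).
Proof.
move=> cf; apply: (measurability _ (RGenOpens.measurableE R)).
move=> _ [_ [a [b ->] <-]]; rewrite setTI; apply: open_borelC.
by move/continuousP: cf; apply; exact: interval_open.
Qed.

Lemma normc_lt_open (x : R[i]) (r : R) : open [set z | normc (z - x) < r].
Proof.
have /continuousP := @normc_sub_continuous R x.
by move/(_ [set y | y < r] (@open_lt _ r)).
Qed.

Lemma nbhs_normc_lt (U : set R[i]) (z : R[i]) : open U -> U z ->
  exists2 e : R, 0 < e & forall w, normc (w - z) < e -> U w.
Proof.
rewrite openE => oU /oU[e /= e0 eU].
have [e' eE] : exists e', e = e'%:C.
  by exists (complex.Re e); rewrite RRe_real// gtr0_real.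
exists e'; first by rewrite -ltcR -eE.
by move=> w zw; apply: eU; rewrite /ball_/= distrC eE normC_normc ltcR.
Qed.

Variable mu : {measure set (borelC R) -> \bar R}.

Lemma open_setC_supp : open (~` supp mu).
Proof.
rewrite openE => z nz.
have [U oU [Uz U0]] : exists2 U, open U & U z /\ ~ (0 < mu U)%E.
  apply: contrapT => h; apply: nz => U oU Uz; apply: contrapT => U0.
  by apply: h; exists U.
have := open_nbhs_nbhs (conj oU Uz); apply: filterS => w Uw sw.
exact/U0/sw.
Qed.

Lemma measurable_supp : measurable (supp mu : set (borelC R)).
Proof.
rewrite -(setCK (supp mu)); apply: measurableC; apply: open_borelC.
exact: open_setC_supp.
Qed.

(* The plane is second countable: the null open sets are exhausted by the
   null discs with rational centre and radius. *)
Lemma measure_setC_supp : mu (~` supp mu) = 0%E.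
Proof.
pose V (q : rat * rat * rat) : set R[i] :=
  [set z | normc (z - (ratr q.1.1 +i* ratr q.1.2)) < ratr q.2].
have oV q : open (V q) by exact: normc_lt_open.
pose W n : set (borelC R) :=
  if unpickle n is Some q then if mu (V q) == 0%E then V q else set0 else set0.
have mW n : measurable (W n).
  by rewrite /W; case: unpickle => // q; case: ifP => // _; apply: open_borelC; exact: oV.
apply: measure_negligible; first by apply: open_borelC; exact: open_setC_supp.
apply: (@negligibleS _ _ _ _ (\bigcup_n W n)); last first.
  apply: negligible_bigcup => n; apply/negligibleP; first exact: mW.
  by rewrite /W; case: unpickle => [q|]; [case: eqP|]; rewrite ?measure0.
move=> z nz.
have [U oU [Uz U0]] : exists2 U, open U & U z /\ ~ (0 < mu U)%E.
  apply: contrapT => h; apply: nz => U oU Uz; apply: contrapT => U0.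
  by apply: h; exists U.
have [e e0 eU] := nbhs_normc_lt oU Uz.
(* Coordinate errors below e/8 put the centre within e/4 of z. A radius between e/4 and e/2 then
   makes the disc contain z and stay within 3e/4 of it, hence inside [U]. *)
have [a] : exists a, ratr a \in `](complex.Re z - e / 8), (complex.Re z + e / 8)[.
  by apply: rat_in_itvoo; lra.
have [b] : exists b, ratr b \in `](complex.Im z - e / 8), (complex.Im z + e / 8)[.
  by apply: rat_in_itvoo; lra.
have [r] : exists r, ratr r \in `](e / 4), (e / 2)[ by apply: rat_in_itvoo; lra.
rewrite !in_itv/= => /andP[r1 r2] /andP[b1 b2] /andP[a1 a2].
pose c : R[i] := ratr a +i* ratr b.
have zc : normc (z - c) < e / 4.
  apply: (le_lt_trans (normc_le_ReIm _)); rewrite !raddfB/=.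
  have -> : e / 4 = e / 8 + e / 8 by lra.
  by rewrite ltrD// ltr_norml; apply/andP; split; lra.
have VU : V (a, b, r) `<=` U.
  move=> w /= wc; apply: eU; rewrite -(subrKA c w).
  apply: (le_lt_trans (le_normcD _ _)); rewrite -[c - z]opprB normcN.
  by move: wc zc; rewrite /V/= -/c; lra.
exists (pickle (a, b, r)); first exact: I.
rewrite /W pickleK.
have -> : mu (V (a, b, r)) = 0%E.
  apply/eqP; rewrite eq_le measure_ge0 andbT leNgt; apply/negP => V0.
  apply: U0; apply: (lt_le_trans V0).
  by apply: le_measure => //; rewrite inE; exact: open_borelC.
by rewrite eqxx; exact: lt_trans zc r1.
Qed.

End support.

Section integration.
Variables (R : realType) (mu : {finite_measure set (borelC R) -> \bar R}).
Hypothesis cS : compact (supp mu).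
Implicit Types f g : R[i] -> R.
Local Open Scope complex_scope.

Lemma compact_supp_bounded f : continuous f ->
  exists M : R, forall z, supp mu z -> `|f z| <= M.
Proof.
move=> cf; have /compact_bounded[M [_ MS]] : compact (f @` supp mu).
  by apply: continuous_compact => //; exact: continuous_subspaceT.
exists (M + 1) => z sz; apply: MS; first by rewrite ltrDl.
by exists z.
Qed.

(** A continuous function may be unbounded on the plane, but the complement of the support is null,
    and on the compact support [f] is bounded while [mu] is finite. *)
Lemma continuous_integrable f : continuous f ->
  mu.-integrable setT (EFin \o (f : borelC R -> R)).
Proof.
move=> cf; have mf := continuous_borelC cf.
have mS : measurable (~` supp mu : set (borelC R)).
  by apply: measurableC; exact: measurable_supp.
apply/(negligible_integrable mS measurableT _ (measure_setC_supp mu)).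
  exact/measurable_EFinP.
rewrite setTD setCK; apply: measurable_bounded_integrable.
- exact: measurable_supp.
- by apply: (le_lt_trans (le_measure mu _ _ (@subsetT _ _)));
    rewrite ?inE//; [exact: measurable_supp|exact: fin_num_fun_lty].
- exact: measurable_funTS.
- have [M fM] := compact_supp_bounded cf.
  exists M; split; first exact: num_real.
  by move=> y My z /= sz; apply: (le_trans (fM z sz)); exact: ltW.
Qed.

Lemma Rintegral_supp f : continuous f ->
  \int[mu]_z f z = \int[mu]_(z in (supp mu : set (borelC R))) f z.
Proof.
move=> cf; have mS : measurable (~` supp mu : set (borelC R)).
  by apply: measurableC; exact: measurable_supp.
rewrite /Rintegral (negligible_integral mS measurableT
  (continuous_integrable cf) (measure_setC_supp mu)).
by rewrite setTD setCK.
Qed.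

Lemma supp_le_Rintegral f g : continuous f -> continuous g ->
  (forall z, supp mu z -> f z <= g z) -> \int[mu]_z f z <= \int[mu]_z g z.
Proof.
move=> cf cg fg; rewrite !Rintegral_supp//; apply: le_Rintegral => //.
- exact: measurable_supp.
- apply: integrableS (continuous_integrable cf) => //; exact: measurable_supp.
- apply: integrableS (continuous_integrable cg) => //; exact: measurable_supp.
Qed.

(** The set where f > f(z)/2 is open and contains a support point, so it has positive measure. As
    [f] is nonnegative only on the support, the integral is first restricted there; this does not
    change the measure of that open set. *)
Lemma supp_Rintegral_gt0 f z : continuous f ->
  (forall z, supp mu z -> 0 <= f z) -> supp mu z -> 0 < f z ->
  0 < \int[mu]_z f z.
Proof.
move=> cf f0 sz fz.
pose e := f z / 2; have e0 : 0 < e by rewrite divr_gt0.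
pose U := [set w | e < f w].
have oU : open U by move/continuousP : cf => /(_ _ (@open_gt _ e)).
have mU : measurable (U : set (borelC R)) by apply: open_borelC.
have Uz : U z by rewrite /U/= /e; lra.
have muU : (0 < mu U)%E := sz _ oU Uz.
have finU : mu U \is a fin_num by exact: fin_num_measure.
rewrite Rintegral_supp//.
have mS := measurable_supp mu.
have iS := integrableS measurableT mS (@subsetT _ _) (continuous_integrable cf).
rewrite -lte_fin fineK; last exact: integrable_fin_num.
apply: (@lt_le_trans _ _
  (\int[mu]_(z in ((supp mu : set (borelC R)) `&` U)) e%:E)%E); last first.
  apply: (@le_trans _ _ (\int[mu]_(z in ((supp mu : set (borelC R)) `&` U)) (f z)%:E)%E).
    apply: ge0_le_integral => //.
    - exact: measurableI.
    - by move=> w _; rewrite lee_fin ltW.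
    - apply/measurable_funTS/measurable_EFinP; exact: continuous_borelC.
    - by move=> w [_ /ltW]; rewrite lee_fin.
  apply: ge0_subset_integral => //.
  - exact: measurableI.
  - exact: measurable_int iS.
rewrite integral_cst; last exact: measurableI.
rewrite /=.
have -> : mu ((supp mu : set (borelC R)) `&` U) = mu U.
  rewrite setIC [RHS](measureDI mu mU mS).
  rewrite [X in _ = (X + _)%E](_ : _ = 0%E) ?add0e// setDE.
  apply: (subset_measure0 _ _ (@subIsetr _ _ _) (measure_setC_supp mu)).
    by apply: measurableI => //; exact: measurableC.
  exact: measurableC.
by rewrite mule_gt0.
Qed.

End integration.

Section continuity.
Variable R : realType.
Implicit Types (z w : R[i]) (f g : R[i] -> R[i]).
Local Open Scope complex_scope.

Lemma complex_ReM z w : complex.Re (z * w) =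
  complex.Re z * complex.Re w - complex.Im z * complex.Im w.
Proof. by case: z => a b; case: w. Qed.

Lemma complex_ImM z w : complex.Im (z * w) =
  complex.Re z * complex.Im w + complex.Im z * complex.Re w.
Proof. by case: z => a b; case: w. Qed.

Lemma conjcM_normc z : z^* * z = (normc z ^+ 2)%:C.
Proof. by rewrite mulrC -sqr_normc normC_normc -rmorphXn. Qed.

Lemma Re_comp_continuous f : continuous f -> continuous (fun z => complex.Re (f z)).
Proof.
by move=> cf z; apply: (@continuous_comp _ _ _ f (@complex.Re R));
  [exact: cf|exact: Re_continuous].
Qed.

Lemma Im_comp_continuous f : continuous f -> continuous (fun z => complex.Im (f z)).
Proof.
by move=> cf z; apply: (@continuous_comp _ _ _ f (@complex.Im R));
  [exact: cf|exact: Im_continuous].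
Qed.

Lemma continuousM_complex f g : continuous f -> continuous g ->
  continuous (fun z => f z * g z).
Proof. by move=> cf cg z; apply: (@continuousM R[i] R[i]); [exact: cf|exact: cg]. Qed.

Lemma sesquilinear_continuous (P Q : {poly R[i]}) :
  continuous (fun z : R[i] => (P.[z])^* * Q.[z]).
Proof.
apply: continuousM_complex; last exact: horner_continuous.
move=> z; apply: (@continuous_comp _ _ _ (horner P) (@conjc R)).
  exact: horner_continuous.
exact: conjc_continuous.
Qed.

Lemma normc_horner_continuous (P : {poly R[i]}) :
  continuous (fun z : R[i] => normc P.[z] ^+ 2).
Proof.
rewrite (_ : (fun _ => _) = fun z => complex.Re ((P.[z])^* * P.[z])).
  exact/Re_comp_continuous/sesquilinear_continuous.
by apply/funext => z; rewrite conjcM_normc.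
Qed.

End continuity.

(** * The inner product of a measure, and multiplication by X - z *)

Section moment_form.
Variable R : realType.
Local Open Scope complex_scope.

Definition moment_form (mu : {measure set (borelC R) -> \bar R})
  (P Q : {poly R[i]}) : R[i] := Cintegral mu (fun z => (P.[z])^* * Q.[z]).

Variable mu : {finite_measure set (borelC R) -> \bar R}.
Hypothesis cS : compact (supp mu).
Implicit Types (P Q : {poly R[i]}) (f g : R[i] -> R[i]).

Let iRe f : continuous f ->
  mu.-integrable setT (EFin \o (fun z : borelC R => complex.Re (f z))).
Proof. by move=> cf; apply: continuous_integrable => //; exact: Re_comp_continuous. Qed.

Let iIm f : continuous f ->
  mu.-integrable setT (EFin \o (fun z : borelC R => complex.Im (f z))).
Proof. by move=> cf; apply: continuous_integrable => //; exact: Im_comp_continuous. Qed.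

Lemma CintegralD f g : continuous f -> continuous g ->
  Cintegral mu (fun z => f z + g z) = Cintegral mu f + Cintegral mu g.
Proof.
move=> cf cg; rewrite /Cintegral; apply/eqP; rewrite eq_complex/=; apply/andP; split.
  rewrite -RintegralD//; [|exact: iRe|exact: iRe].
  by apply/eqP/eq_Rintegral => z _; rewrite raddfD.
rewrite -RintegralD//; [|exact: iIm|exact: iIm].
by apply/eqP/eq_Rintegral => z _; rewrite raddfD.
Qed.

Lemma CintegralZl a f : continuous f ->
  Cintegral mu (fun z => a * f z) = a * Cintegral mu f.
Proof.
move=> cf; rewrite /Cintegral; case: a => a b; apply/eqP; rewrite eq_complex/=.
have ire := iRe cf; have iim := iIm cf.
apply/andP; split.
  rewrite -!RintegralZl// -RintegralB//.
  - by apply/eqP/eq_Rintegral => z _; rewrite complex_ReM.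
  - exact: integrableZl ire.
  - exact: integrableZl iim.
rewrite -!RintegralZl// -RintegralD//.
- by apply/eqP/eq_Rintegral => z _; rewrite complex_ImM.
- exact: integrableZl iim.
- exact: integrableZl ire.
Qed.

Lemma Cintegral_conj f : continuous f ->
  Cintegral mu (fun z => (f z)^*) = (Cintegral mu f)^*.
Proof.
move=> cf; rewrite /Cintegral; apply/eqP; rewrite eq_complex/=; apply/andP; split.
  by apply/eqP/eq_Rintegral => z _; case: (f z).
rewrite -mulN1r -RintegralZl//; last exact: iIm.
by apply/eqP/eq_Rintegral => z _; rewrite mulN1r; case: (f z).
Qed.

Lemma Cintegral_real (h : R[i] -> R) :
  Cintegral mu (fun z => (h z)%:C) = (\int[mu]_z h z)%:C.
Proof. by rewrite /Cintegral/= Rintegral_cst// mul0r. Qed.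

Lemma moment_form_diag P :
  moment_form mu P P = (\int[mu]_z (normc P.[z] ^+ 2))%:C.
Proof.
rewrite /moment_form -Cintegral_real; congr Cintegral.
by apply/funext => z; rewrite conjcM_normc.
Qed.

Lemma moment_form_inner_product : infinite_set (supp mu) ->
  inner_product (moment_form mu).
Proof.
move=> iS; split => [a P Q S|P Q|P P0].
- rewrite /moment_form -CintegralZl; last exact: sesquilinear_continuous.
  rewrite -CintegralD; last 2 first.
  + apply: continuousM_complex; last exact: sesquilinear_continuous.
    exact: cst_continuous.
  + exact: sesquilinear_continuous.
  congr Cintegral; apply/funext => z.
  by rewrite hornerD hornerZ mulrDr mulrCA.
- rewrite /moment_form -[RHS]/((Cintegral _ _)^*) -Cintegral_conj; last first.
    exact: sesquilinear_continuous.
  congr Cintegral; apply/funext => z.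
  by rewrite rmorphM/= conjcK mulrC.
- rewrite moment_form_diag ltcR.
  (* Definiteness comes from the infinite support: a nonzero polynomial has finitely many roots, so
     some support point is not a root. *)
  have [z sz Pz] : exists2 z, supp mu z & P.[z] != 0.
    apply: contrapT => h; apply: iS.
    have [r Pr] := closed_field_poly_normal P.
    apply: (@sub_finite_set _ _ [set` r]) => // z sz.
    have : root P z by apply/negPn/negP => nz; apply: h; exists z.
    by rewrite Pr rootZ ?lead_coef_eq0// root_prod_XsubC.
  apply: (@supp_Rintegral_gt0 _ _ cS _ z) => //.
  + exact: normc_horner_continuous.
  + by move=> w _; exact: sqr_ge0.
  + rewrite exprn_gt0// lt_neqAle normc_ge0 andbT eq_sym.
    by apply: contraNneq Pz => /ComplexField.Normc.eq0_normc/eqP.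
Qed.

End moment_form.

Lemma continuousM_real (T : topologicalType) (R : numFieldType) (f g : T -> R) :
  continuous f -> continuous g -> continuous (fun z => f z * g z).
Proof. by move=> cf cg z; apply: continuousM; [exact: cf|exact: cg]. Qed.

Section moment_form_bounds.
Variables (R : realType) (mu : {finite_measure set (borelC R) -> \bar R}).
Hypothesis cS : compact (supp mu).
Implicit Types P Q : {poly R[i]}.
Local Open Scope complex_scope.

(** The real part of u <P, (X - z) P> is the integral of Re(u (w - z)) |P(w)|^2, at least d <P,P>,
    and |u| <= 1 lets the modulus absorb [u]. The conjugate of [u] is normal to a line separating z
    from the support. *)
Lemma moment_form_shift_ge (z u : R[i]) (d : R) P : normc u <= 1 ->
  (forall w, supp mu w -> d <= complex.Re (u * (w - z))) ->
  d%:C * moment_form mu P P <= `|moment_form mu P (('X - z%:P) * P)|.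
Proof.
move=> u1 hu.
have cP := @normc_horner_continuous R P.
have cl : continuous (fun w => u * (w - z)).
  rewrite (_ : (fun _ => _) = horner (u *: ('X - z%:P))); first exact: horner_continuous.
  by apply/funext => w; rewrite hornerZ hornerXsubC.
have clP : continuous (fun w => complex.Re (u * (w - z)) * normc P.[w] ^+ 2).
  apply: continuousM_real; last exact: cP.
  exact: (Re_comp_continuous cl).
set F := moment_form mu P (('X - z%:P) * P).
change (d%:C * moment_form mu P P <= (normc F)%:C).
rewrite moment_form_diag -rmorphM/= lecR.
apply: (@le_trans _ _ (complex.Re (u * F))).
  rewrite /F /moment_form -CintegralZl//; last exact: sesquilinear_continuous.
  rewrite /Cintegral/= -RintegralZl//; last exact: continuous_integrable.
  have -> : \int[mu]_z0 complex.Re (u * ((P.[z0])^* * (('X - z%:P) * P).[z0])) =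
      \int[mu]_w (complex.Re (u * (w - z)) * normc P.[w] ^+ 2).
    apply: eq_Rintegral => w _; rewrite hornerM hornerXsubC.
    have -> : u * ((P.[w])^* * ((w - z) * P.[w])) =
      (u * (w - z)) * (normc P.[w] ^+ 2)%:C by rewrite -conjcM_normc; ring.
    by rewrite complex_ReM/= mulr0 subr0.
  apply: supp_le_Rintegral => //.
    apply: continuousM_real; last exact: cP.
    exact: cst_continuous.
  by move=> w sw; rewrite ler_wpM2r ?sqr_ge0 ?hu.
apply: (le_trans (ler_norm _)); apply: (le_trans (normc_ge_abs_Re _)).
by rewrite ComplexField.Normc.normcM ler_piMl ?normc_ge0.
Qed.

Lemma moment_form_shift_le (z : R[i]) (D : R) P :
  (forall w, supp mu w -> normc (w - z) <= D) ->
  moment_form mu (('X - z%:P) * P) (('X - z%:P) * P) <=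
  D%:C ^+ 2 * moment_form mu P P.
Proof.
move=> hD; rewrite !moment_form_diag -rmorphXn -rmorphM/= lecR.
have cP := @normc_horner_continuous R P.
rewrite -RintegralZl//; last exact: continuous_integrable.
apply: supp_le_Rintegral => //.
- exact: normc_horner_continuous.
- apply: continuousM_real; last exact: cP.
  exact: cst_continuous.
- move=> w sw; rewrite hornerM hornerXsubC ComplexField.Normc.normcM exprMn.
  rewrite ler_wpM2r ?sqr_ge0// ler_pXn2r ?nnegrE ?normc_ge0 ?hD//.
  exact: le_trans (normc_ge0 _) (hD _ sw).
Qed.

(** The bridge to the abstract section: the orthonormal polynomials of [nux mu x] are studied
    entirely inside the inner product of [mu]. *)
Lemma moment_form_nux (x : R[i]) P Q :
  moment_form (nux mu x) P Q =
  moment_form mu (('X - x%:P) * P) (('X - x%:P) * Q).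
Proof.
have cPQ := @sesquilinear_continuous R P Q.
have mh : measurable_fun setT (fun z : borelC R => normc (z - x) ^+ 2).
  apply: continuous_borelC.
  rewrite (_ : (fun _ => _) = fun z => normc ('X - x%:P).[z] ^+ 2).
    exact: normc_horner_continuous.
  by apply/funext => z; rewrite hornerXsubC.
have h0 (z : borelC R) : 0 <= normc (z - x) ^+ 2 by exact: sqr_ge0.
have dens (f : R[i] -> R) : continuous f ->
    \int[nux mu x]_z f z = \int[mu]_z (f z * normc (z - x) ^+ 2).
  move=> /continuous_borelC mf.
  by apply: (@Rintegral_density _ _ _ mu (nux mu x) _ h0 mh _ f mf).
have E (z : R[i]) : ((('X - x%:P) * P).[z])^* * (('X - x%:P) * Q).[z] =
    ((P.[z])^* * Q.[z]) * (normc (z - x) ^+ 2)%:C.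
  by rewrite !hornerM !hornerXsubC rmorphM/= -conjcM_normc; ring.
rewrite /moment_form /Cintegral; apply/eqP; rewrite eq_complex/=; apply/andP; split.
  rewrite dens; last exact: Re_comp_continuous.
  by apply/eqP/eq_Rintegral => z _; rewrite E [in RHS]complex_ReM/= mulr0 subr0.
rewrite dens; last exact: Im_comp_continuous.
by apply/eqP/eq_Rintegral => z _; rewrite E [in RHS]complex_ImM/= mulr0 add0r.
Qed.

End moment_form_bounds.

(** * Strict separation of a point from a compact plane set *)

Section planar_separation.
Variable R : realType.
Implicit Types (a b w : R * R).

Let dot a b : R := a.1 * b.1 + a.2 * b.2.

(* [a = (a1, a2)] and [b = (b1, b2)] form the largest angle in a set of
   directions; if [a + b] does not separate [w], then [w] is either a
   nonpositive combination of [a] and [b], or shorter than a unit vector. *)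
Let short_vector (k al be : R) : - 1 < k -> k <= 0 -> 0 < al ->
  al + be <= 0 -> k <= al * k + be ->
  al ^+ 2 + be ^+ 2 + 2 * al * be * k <> 1.
Proof.
move=> k1 k0 al0 abe kbe.
pose b := - be; pose m := - k.
have b0 : 0 < b by rewrite /b; lra.
have bm : b <= m * (1 - al) by rewrite /b /m; nra.
have m0 : 0 <= m by rewrite /m; lra.
have m1 : m < 1 by rewrite /m; lra.
have al1 : al < 1.
  rewrite ltNge; apply/negP => al1.
  have h : m * (1 - al) <= 0 by apply: mulr_ge0_le0 => //; lra.
  lra.
have -> : be = - b by rewrite /b opprK.
have -> : k = - m by rewrite /m opprK.
have mal : 0 <= m * (1 - al) by lra.
(* The squared length al^2 + b^2 + 2 al m b grows with [b >= 0]. At the largest admissible value b =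
   m (1 - al) it equals al^2 + m^2 (1 - al^2), which is below 1 because m < 1 and al < 1. *)
have h1 : b ^+ 2 <= (m * (1 - al)) ^+ 2 by rewrite ler_pXn2r ?nnegrE//; lra.
have h2 : 2 * al * m * b <= 2 * al * m * (m * (1 - al)).
  by rewrite ler_wpM2l// !mulr_ge0//; lra.
have h3 : m ^+ 2 * (1 - al ^+ 2) < 1 * (1 - al ^+ 2).
  by rewrite ltr_pM2r; nra.
have h4 : al ^+ 2 + (m * (1 - al)) ^+ 2 + 2 * al * m * (m * (1 - al)) =
  al ^+ 2 + m ^+ 2 * (1 - al ^+ 2) by ring.
have -> : al ^+ 2 + (- b) ^+ 2 + 2 * al * - b * - m =
  al ^+ 2 + b ^+ 2 + 2 * al * m * b by ring.
lra.
Qed.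

Lemma unit_separation a b w :
  dot a a = 1 -> dot b b = 1 -> dot w w = 1 ->
  dot a b <= dot a w -> dot a b <= dot b w -> - 1 < dot a b ->
  (forall s t : R, 0 <= s -> 0 <= t ->
     w.1 + s * a.1 + t * b.1 = 0 -> w.2 + s * a.2 + t * b.2 <> 0) ->
  0 < dot (a.1 + b.1, a.2 + b.2) w.
Proof.
move=> aa bb ww aw bw k1 nz; rewrite ltNge; apply/negP => uw.
set k := dot a b in aw bw k1.
have uE : dot (a.1 + b.1, a.2 + b.2) w = dot a w + dot b w by rewrite /dot/=; ring.
rewrite uE in uw.
have k0 : k <= 0 by lra.
pose D := a.1 * b.2 - a.2 * b.1.
(* Lagrange's identity for unit vectors. With -1 < k <= 0 the determinant is nonzero, and Cramer's
   rule gives the coordinates [al'], [be'] of [w] in the basis [a], [b]. *)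
have D2 : D ^+ 2 = 1 - k ^+ 2.
  rewrite /D /k -[1](mulr1 1) -{1}aa -bb /dot; ring.
have D0 : D != 0.
  by apply/eqP => D0; move: D2; rewrite D0 expr0n/=; nra.
pose al' := (w.1 * b.2 - w.2 * b.1) / D.
pose be' := (a.1 * w.2 - a.2 * w.1) / D.
have w1 : w.1 = al' * a.1 + be' * b.1 by rewrite /al' /be' /D; field.
have w2 : w.2 = al' * a.2 + be' * b.2 by rewrite /al' /be' /D; field.
have awE : dot a w = al' + be' * k.
  rewrite /k -[al']mulr1 -aa /dot w1 w2; ring.
have bwE : dot b w = al' * k + be'.
  rewrite /k -[be' in RHS]mulr1 -bb /dot w1 w2; ring.
have wwE : al' ^+ 2 + be' ^+ 2 + 2 * al' * be' * k = 1.
  rewrite -[RHS]ww.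
  have -> : dot w w = al' ^+ 2 * dot a a + be' ^+ 2 * dot b b + 2 * al' * be' * k.
    by rewrite /k /dot w1 w2; ring.
  by rewrite aa bb !mulr1.
(* The two products add up to (al' + be') (1 + k), and 1 + k > 0. *)
have abe : al' + be' <= 0 by rewrite awE bwE in uw; nra.
have [al0|al0] := ltP 0 al'.
  by apply: (short_vector k1 k0 al0 abe _ wwE); rewrite -bwE.
have [be0|be0] := ltP 0 be'.
  apply: (@short_vector k be' al' k1 k0 be0).
  - by rewrite addrC.
  - by rewrite addrC mulrC [k * _]mulrC -awE.
  - by rewrite -[RHS]wwE; ring.
apply: (nz (- al') (- be')); rewrite ?oppr_ge0//.
- by rewrite w1; ring.
- by rewrite w2; ring.
Qed.

End planar_separation.

Section separation.
Variable R : realType.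
Implicit Types (a b c z w u : R[i]) (S X : set R[i]).
Local Open Scope complex_scope.
Local Open Scope convex_scope.

Lemma convex_set_pair X a b (t : R) :
  @convex_set R (Rcomplex R) X -> X a -> X b -> 0 <= t <= 1 ->
  X (t%:C * a + (1 - t)%:C * b).
Proof.
move=> cX Xa Xb t01.
move: t01 => /andP[t0 t1].
have := cX a b (Itv01 t0 t1) (mem_set Xa) (mem_set Xb) => /set_mem.
congr X; case: a {Xa} => a1 a2; case: b {Xb} => b1 b2.
apply/eqP; rewrite eq_complex/= !mul0r !subr0 !addr0.
by rewrite !eqxx.
Qed.

(** Solving the relation gives z = (a + s b + t c) / (1 + s + t), reached by two binary combinations
    through the point (a + s b) / (1 + s). *)
Lemma convex_set_triple X a b c (s t : R) z :
  @convex_set R (Rcomplex R) X -> X a -> X b -> X c -> 0 <= s -> 0 <= t ->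
  (a - z) + s%:C * (b - z) + t%:C * (c - z) = 0 -> X z.
Proof.
move=> cX Xa Xb Xc s0 t0 zE.
have s1 : 0 < 1 + s by lra.
have st : 0 < 1 + s + t by lra.
have nz (r : R) : 0 < r -> r%:C != 0.
  by move=> r0; rewrite -(rmorph0 (real_complex R)) (inj_eq (@complexI R)) gt_eqF.
have nz1 : 1 + s%:C != 0 by have := nz _ s1; rewrite rmorphD rmorph1.
have nz2 : 1 + s%:C + t%:C != 0 by have := nz _ st; rewrite !rmorphD rmorph1.
pose p := (1 / (1 + s))%:C * a + (1 - 1 / (1 + s))%:C * b.
have Xp : X p.
  apply: convex_set_pair => //; rewrite divr_ge0 ?ler01 ?(ltW s1)//=.
  by rewrite ler_pdivrMr//; lra.
have -> : z = ((1 + s) / (1 + s + t))%:C * p + (1 - (1 + s) / (1 + s + t))%:C * c.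
  have -> : p = (a + s%:C * b) / (1 + s)%:C.
    rewrite /p; have -> : 1 - 1 / (1 + s) = s / (1 + s) by field; lra.
    by rewrite !rmorphM !fmorphV !rmorphD !rmorph1; field; exact: nz1.
  have -> : 1 - (1 + s) / (1 + s + t) = t / (1 + s + t) by field; lra.
  rewrite !rmorphM !fmorphV !rmorphD !rmorph1; apply: (mulfI nz2).
  transitivity (a + s%:C * b + t%:C * c).
    by apply/eqP; rewrite eq_sym -subr_eq0 -[X in _ == X]zE; apply/eqP; ring.
  by field; rewrite nz1 nz2.
apply: convex_set_pair => //; rewrite divr_ge0 ?(ltW s1) ?(ltW st)//=.
by rewrite ler_pdivrMr//; lra.
Qed.

End separation.

Lemma direction_continuous (K : numFieldType) (z w : K) : w != z ->
  {for w, continuous (fun v : K => (v - z) / `|v - z|)}.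
Proof.
move=> wz.
have c : {for w, continuous (fun v : K => v - z)}.
  by apply: continuousB; [exact: cvg_id|exact: cst_continuous].
apply: continuousM => //; apply: continuousV; first by rewrite normr_eq0 subr_eq0.
apply: (@continuous_comp _ _ _ (fun v : K => v - z) (@Num.norm K K)) => //.
exact: norm_continuous.
Qed.

Lemma continuousD_real (T : topologicalType) (R : numFieldType) (f g : T -> R) :
  continuous f -> continuous g -> continuous (fun z => f z + g z).
Proof. by move=> cf cg z; apply: continuousD; [exact: cf|exact: cg]. Qed.

Lemma normc_real (R : rcfType) (r : R) : normc (real_complex R r) = `|r|.
Proof. by rewrite /normc /= expr0n addr0 sqrtr_sqr. Qed.

Section compact_separation.
Variables (R : realType) (S X : set R[i]) (z : R[i]).
Local Open Scope complex_scope.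
Hypotheses (S0 : S !=set0) (cS : compact S) (SX : S `<=` X).
Hypotheses (cX : @convex_set R (Rcomplex R) X) (Xz : ~ X z).

Let dir (w : R[i]) : R[i] := (w - z) / (normc (w - z))%:C.

Let Swz w : S w -> w != z.
Proof. by move=> /SX Xw; apply: contra_notN Xz => /eqP <-. Qed.

Let normc_gt0 w : S w -> 0 < normc (w - z).
Proof. by move=> /Swz; rewrite -subr_eq0 -normr_gt0 normC_normc ltcR. Qed.

Let normc_neq0 w : S w -> (normc (w - z))%:C != 0.
Proof.
move=> /normc_gt0 w0; rewrite -(rmorph0 (real_complex R)).
by rewrite (inj_eq (@complexI R)) gt_eqF.
Qed.

(** Multiplying a vanishing combination by |w - z| gives a relation between w - z, a - z and b - z
    with coefficient 1 on the first and nonnegative ones on the others; convexity would then put z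
    in [X]. *)
Let dir_nz a b w (s t : R) : S a -> S b -> S w -> 0 <= s -> 0 <= t ->
  dir w + s%:C * dir a + t%:C * dir b <> 0.
Proof.
move=> sa sb sw s0 t0 E; apply: Xz.
have aw := divr_gt0 (normc_gt0 sw) (normc_gt0 sa).
have bw := divr_gt0 (normc_gt0 sw) (normc_gt0 sb).
have sa0 : 0 <= s * (normc (w - z) / normc (a - z)) by apply: mulr_ge0 => //; exact: ltW.
have tb0 : 0 <= t * (normc (w - z) / normc (b - z)) by apply: mulr_ge0 => //; exact: ltW.
apply: (convex_set_triple cX (SX sw) (SX sa) (SX sb) sa0 tb0).
transitivity ((normc (w - z))%:C * (dir w + s%:C * dir a + t%:C * dir b)).
  rewrite !rmorphM !fmorphV /dir; field.
  by rewrite !normc_neq0.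
by rewrite E mulr0.
Qed.

Let dir_compact : compact (dir @` S).
Proof.
apply: continuous_compact => //; apply: continuous_in_subspaceT => w /set_mem sw.
exact: (@direction_continuous R[i] z w (Swz sw)).
Qed.

Let dir_unit w : S w ->
  complex.Re (dir w) * complex.Re (dir w) + complex.Im (dir w) * complex.Im (dir w) = 1.
Proof.
move=> sw; rewrite -!expr2 -normc_sqr /dir ComplexField.Normc.normcM.
rewrite ComplexField.Normc.normcV normc_real gtr0_norm ?normc_gt0//.
by rewrite divff ?expr1n// gt_eqF// normc_gt0.
Qed.

(** Compactness provides two directions from z into [S] with least inner product, that is, enclosing
    the largest angle. The bisector of that angle is normal to a separating line. *)
Lemma compact_separation : exists u d,
  [/\ normc u <= 1, 0 < d & forall w, S w -> d <= complex.Re (u * (w - z))].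
Proof.
pose g (p : R[i] * R[i]) :=
  complex.Re p.1 * complex.Re p.2 + complex.Im p.1 * complex.Im p.2.
have cg : continuous g.
  have c1 : continuous (fun p : R[i] * R[i] => p.1) by move=> p; exact: cvg_fst.
  have c2 : continuous (fun p : R[i] * R[i] => p.2) by move=> p; exact: cvg_snd.
  have cR (h : R[i] * R[i] -> R[i]) :
      continuous h -> continuous (fun p => complex.Re (h p)).
    move=> ch p; apply: (@continuous_comp _ _ _ h (@complex.Re R)); first exact: ch.
    exact: Re_continuous.
  have cI (h : R[i] * R[i] -> R[i]) :
      continuous h -> continuous (fun p => complex.Im (h p)).
    move=> ch p; apply: (@continuous_comp _ _ _ h (@complex.Im R)); first exact: ch.
    exact: Im_continuous.
  apply: continuousD_real; apply: continuousM_real.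
  - exact: cR c1.
  - exact: cR c2.
  - exact: cI c1.
  - exact: cI c2.
have [|[a' b'] /set_mem[/= [a sa <-] [b sb <-]] gmin] :=
    compact_EVT_min _ (compact_setX dir_compact dir_compact) (continuous_subspaceT cg).
  by have [s ss] := S0; exists (dir s, dir s); split; exists s.
have gle v w : S v -> S w -> g (dir a, dir b) <= g (dir v, dir w).
  by move=> sv sw; apply/gmin/mem_set; split=> /=; [exists v|exists w].
(* The conjugate makes Re(u0 w) the real inner product of w with [dir a + dir b]. *)
pose u0 := (dir a + dir b)^*.
have ReE w : complex.Re (u0 * w) =
    (complex.Re (dir a) + complex.Re (dir b)) * complex.Re w +
    (complex.Im (dir a) + complex.Im (dir b)) * complex.Im w.
  rewrite complex_ReM /u0; case: (dir a) => a1 a2; case: (dir b) => b1 b2 /=.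
  by rewrite mulNr opprK.
(* Otherwise the two unit directions are opposite, and z lies on a segment between two points of
   [S]. *)
have gab : -1 < g (dir a, dir b).
  rewrite ltNge; apply/negP; rewrite /g/= => gab.
  have ua := dir_unit sa; have ub := dir_unit sb.
  have sq : (complex.Re (dir a) + complex.Re (dir b)) ^+ 2 +
      (complex.Im (dir a) + complex.Im (dir b)) ^+ 2 <= 0 by nra.
  have /andP[/eqP h1 /eqP h2] : (complex.Re (dir a) + complex.Re (dir b) == 0) &&
      (complex.Im (dir a) + complex.Im (dir b) == 0).
    rewrite -[X in X && _]sqrf_eq0 -[X in _ && X]sqrf_eq0 -paddr_eq0 ?sqr_ge0//.
    by rewrite eq_le sq addr_ge0 ?sqr_ge0.
  apply: (@dir_nz b b a 1 0) => //; rewrite rmorph1 mul1r rmorph0 mul0r addr0.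
  by apply/eqP; rewrite eq_complex/= !raddfD/= h1 h2 !eqxx.
have sep w : S w -> 0 < complex.Re (u0 * dir w).
  move=> sw; rewrite ReE.
  apply: (@unit_separation R (complex.Re (dir a), complex.Im (dir a))
    (complex.Re (dir b), complex.Im (dir b))
    (complex.Re (dir w), complex.Im (dir w))) => //=; rewrite ?dir_unit//.
  - exact: (gle a w sa sw).
  - exact: (gle b w sb sw).
  - move=> s t s0 t0 e1 e2; apply: (dir_nz sa sb sw s0 t0).
    move: e1 e2; move: (dir w) (dir a) (dir b) => [w1 w2] [a1 a2] [b1 b2] /= e1 e2.
    by apply/eqP; rewrite eq_complex/= !mul0r !subr0 !addr0 e1 e2 !eqxx.
have u00 : 0 < normc u0.
  rewrite lt_neqAle normc_ge0 andbT eq_sym.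
  apply/eqP => /ComplexField.Normc.eq0_normc u00.
  by have := sep _ sa; rewrite u00 mul0r ltxx.
pose u := (normc u0)^-1%:C * u0.
have ch : continuous (fun w => complex.Re (u * (w - z))).
  apply: Re_comp_continuous.
  rewrite (_ : (fun _ => _) = horner (u *: ('X - z%:P))); first exact: horner_continuous.
  by apply/funext => w; rewrite hornerZ hornerXsubC.
(* Pointwise positivity becomes a uniform gap: [d] is the minimum attained on the compact set
   [S]. *)
have [w0 /set_mem sw0 hmin] := compact_EVT_min S0 cS (continuous_subspaceT ch).
exists u, (complex.Re (u * (w0 - z))); split.
- rewrite /u ComplexField.Normc.normcM normc_real ger0_norm ?invr_ge0 ?(ltW u00)//.
  by rewrite mulVf// gt_eqF.
- have -> : u * (w0 - z) = ((normc u0)^-1 * normc (w0 - z))%:C * (u0 * dir w0).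
    rewrite /u rmorphM /dir -!mulrA; congr (_ * _); rewrite [RHS]mulrCA; congr (_ * _).
    by rewrite mulrCA divff ?mulr1 ?normc_neq0.
  rewrite complex_ReM/= mul0r subr0 mulr_gt0 ?sep//.
  by rewrite mulr_gt0 ?invr_gt0 ?normc_gt0.
- by move=> w sw; apply/hmin/mem_set.
Qed.

End compact_separation.

(** * Uniform estimates on the sphere *)

Section closed_disc.
Variable R : realType.
Local Open Scope complex_scope.

Lemma normc_continuous : continuous (fun z : R[i] => normc z).
Proof.
move=> z; have := @normc_sub_continuous R 0 z.
by rewrite (_ : (fun _ => _) = (fun w => normc w))// ; apply/funext => w; rewrite subr0.
Qed.

Lemma complex_pair_continuous : continuous (fun p : R * R => p.1 +i* p.2 : R[i]).
Proof.
move=> p; apply/(@cvgrPdist_lt _ _ _ (nbhs p)) => e e0.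
have [r eE] : exists r, e = r%:C.
  by exists (complex.Re e); rewrite RRe_real// gtr0_real.
have r2 : 0 < r / 2 by rewrite divr_gt0// -ltcR -eE.
exists (ball p.1 (r / 2), ball p.2 (r / 2)).
  by split; exact: nbhsx_ballx.
move=> [a b] [/= pa pb]; rewrite eE normC_normc ltcR.
apply: (le_lt_trans (normc_le_ReIm _)) => /=.
by rewrite [ltRHS](splitr r); apply: ltrD; rewrite ?opprB.
Qed.

Lemma closed_disc (r : R) : closed [set z : R[i] | normc z <= r].
Proof.
have /continuous_closedP := normc_continuous.
by move/(_ _ (@closed_le _ r)).
Qed.

Lemma compact_disc (r : R) : compact [set z : R[i] | normc z <= r].
Proof.
apply: (@subclosed_compact _ _ ((fun p : R * R => p.1 +i* p.2 : R[i]) @`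
  (`[- r, r]%classic `*` `[- r, r]%classic))).
- exact: closed_disc.
- apply: continuous_compact; last first.
    exact: compact_setX (@segment_compact _ _ _) (@segment_compact _ _ _).
  exact: continuous_subspaceT complex_pair_continuous.
- move=> [a b] zr; exists (a, b) => //.
  have := normc_ge_abs_Re (a +i* b); have := normc_ge_abs_Im (a +i* b).
  move=> /= /le_trans/(_ zr) ib /le_trans/(_ zr) ia.
  by split => /=; rewrite in_itv/= -ler_norml.
Qed.

End closed_disc.

Section sphere_estimates.
Variables (R : realType) (mu : {finite_measure set (borelC R) -> \bar R}).
Variable x : R[i].
Hypotheses (cS : compact (supp mu)) (iS : infinite_set (supp mu)).
Local Open Scope complex_scope.

Let p := orthonormal_poly mu.
Let q := orthonormal_poly (nux mu x).
Let E (n : nat) : R := normc (p n).[x] ^+ 2 / \sum_(j < n) normc (p j).[x] ^+ 2.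

Lemma orthonormal_polyP : orthonormal_for (moment_form mu) p.
Proof.
have [r rP] := orthonormal_for_exists (moment_form_inner_product cS iS).
exact: (@xgetI _ (fun=> 0) [set p | orthonormal_polys mu p] r rP).
Qed.

Let nu_form : moment_form (nux mu x) =
  (fun P Q => moment_form mu (('X - x%:P) * P) (('X - x%:P) * Q)).
Proof. by apply/funext => P; apply/funext => Q; rewrite moment_form_nux. Qed.

Lemma orthonormal_poly_nuxP : orthonormal_for (moment_form (nux mu x)) q.
Proof.
have ip := moment_form_inner_product cS iS.
have [r rP] : exists r, orthonormal_for (moment_form (nux mu x)) r.
  apply: orthonormal_for_exists; rewrite nu_form; split=> [a P Q S|P Q|P P0].
  - by rewrite mulrDr -scalerAr (ipDr ip) (ipZr ip).
  - exact: ipC.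
  - by apply: (ip_gt0 ip); rewrite mulf_neq0// polyXsubC_eq0.
exact: (@xgetI _ (fun=> 0) [set p | orthonormal_polys (nux mu x) p] r rP).
Qed.

Let oq : orthonormal_for
  (fun P Q => moment_form mu (('X - x%:P) * P) (('X - x%:P) * Q)) q.
Proof. by rewrite -nu_form; exact: orthonormal_poly_nuxP. Qed.

Let EC n : `|(p n).[x]| ^+ 2 / \sum_(j < n) `|(p j).[x]| ^+ 2 = (E n)%:C :> R[i].
Proof.
rewrite /E rmorphM fmorphV rmorphXn rmorph_sum; congr (_ / _).
by apply: eq_bigr => j _; rewrite rmorphXn.
Qed.

Let E_ge0 n : 0 <= E n.
Proof. by rewrite divr_ge0 ?sqr_ge0// sumr_ge0// => j _; exact: sqr_ge0. Qed.

Let F n := sphere_ratio (('X - x%:P) * q n.-1) (p n).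

Lemma sphere_ratio_infty n : (0 < n)%N -> normc (F n None - 1) <= E n.
Proof.
move=> n0; have := christoffel_lead_ratio (moment_form_inner_product cS iS)
  orthonormal_polyP oq n0.
by rewrite EC normC_normc lecR.
Qed.

Lemma sphere_ratio_some n (z u : R[i]) (d D : R) : (0 < n)%N -> 0 < d ->
  normc u <= 1 ->
  (forall w, supp mu w -> d <= complex.Re (u * (w - z))) ->
  (forall w, supp mu w -> normc (w - z) <= D) ->
  normc (F n (Some z) - 1) <= E n + D / d * Num.sqrt (E n).
Proof.
move=> n0 d0 u1 hd hD.
have [w0 sw0] : supp mu !=set0 by exact: infinite_setN0.
have D0 : 0 <= D by apply: le_trans (hD _ sw0); exact: normc_ge0.
have d0C : 0 < d%:C by rewrite ltcR.
have D0C : 0 <= D%:C by rewrite lecR.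
have := @christoffel_ratio _ _ (moment_form_inner_product cS iS) p q x
  orthonormal_polyP oq n z d%:C D%:C n0 d0C D0C.
move=> /(_ (fun P => moment_form_shift_ge cS P u1 hd)
  (fun P => moment_form_shift_le cS P hD)).
rewrite /= EC.
have -> : sqrtC (E n)%:C = (Num.sqrt (E n))%:C.
  apply/eqP; rewrite -(@eqrXn2 _ 2)// ?sqrtC_ge0 ?lecR ?sqrtr_ge0//.
  by rewrite sqrtCK -rmorphXn/= sqr_sqrtr.
rewrite -fmorphV -!rmorphM -rmorphD normC_normc lecR.
by [].
Qed.

Let supp0 : supp mu !=set0. Proof. exact: infinite_setN0. Qed.

Lemma supp_bounded : exists2 M : R, 0 <= M & forall w, supp mu w -> normc w <= M.
Proof.
have [M hM] := compact_supp_bounded cS (@normc_continuous R).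
exists M => [|w sw].
  by have [w sw] := supp0; exact: le_trans (normr_ge0 _) (hM _ sw).
by rewrite -[normc w]ger0_norm ?normc_ge0// hM.
Qed.

(** One neighbourhood and one constant serve every n >= 1. The case n = 0 is left out because the
    numerator uses index [n.-1]. *)
Let locally_bounded (w : riemann_sphere R) := exists2 C : R, 0 <= C &
  \forall v \near w, forall n, (0 < n)%N ->
    normc (F n v - 1) <= E n + C * Num.sqrt (E n).

Lemma sphere_ratio_bound_near_infty : locally_bounded None.
Proof.
have [M M0 hM] := supp_bounded.
(* A neighbourhood of infinity is the complement of a compact disc. There d = |z| - M and D = |z| +
   M are admissible, and D / d <= 3 as soon as |z| >= 2M. *)
exists 3 => //; exists [set z : R[i] | normc z <= 2 * M + 1].
  by split; [exact: compact_disc|exact: closed_disc].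
move=> v [[z zM <-]|->] n n0; last first.
  by apply: (le_trans (sphere_ratio_infty n0)); rewrite lerDl mulr_ge0// sqrtr_ge0.
have {}zM : 2 * M + 1 < normc z by rewrite ltNge; exact/negP.
have nz : 0 < normc z by lra.
have d0 : 0 < normc z - M by lra.
(* The chosen [u] encodes the unit vector from z towards the origin: Re(u (w - z)) = |z| -
   Re(conj(z) w) / |z| >= |z| - M. *)
have un : normc (- (z^* / (normc z)%:C)) <= 1.
  rewrite normcN ComplexField.Normc.normcM ComplexField.Normc.normcV normc_real.
  rewrite gtr0_norm//.
  have -> : normc z^* = normc z by apply: (@complexI R); rewrite -!normC_normc normcJ.
  by rewrite divff// gt_eqF.
apply: (le_trans (sphere_ratio_some (u := - (z^* / (normc z)%:C)) (d := normc z - M)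
  (D := normc z + M) n0 d0 un _ _)).
- move=> w sw.
  have -> : - (z^* / (normc z)%:C) * (w - z) =
      (normc z)%:C - (normc z)^-1%:C * (z^* * w).
    have nzC : (normc z)%:C != 0 :> R[i].
      by rewrite -(rmorph0 (real_complex R)) (inj_eq (@complexI R)) gt_eqF.
    rewrite [X in _ = X - _](_ : _ = z^* * z / (normc z)%:C).
      by rewrite fmorphV; field.
    by rewrite conjcM_normc rmorphXn expr2 mulfK.
  rewrite raddfB/= complex_ReM/= mul0r subr0 lerD2l lerN2.
  rewrite mulrC ler_pdivrMr//.
  apply: (le_trans (ler_norm _)); apply: (le_trans (normc_ge_abs_Re _)).
  rewrite ComplexField.Normc.normcM.
  have -> : normc z^* = normc z by apply: (@complexI R); rewrite -!normC_normc normcJ.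
  by rewrite mulrC ler_wpM2r ?hM// ltW.
- move=> w sw; apply: (le_trans (le_normcD _ _)).
  by rewrite normcN addrC lerD2l hM.
- rewrite lerD2l ler_wpM2r ?sqrtr_ge0// ler_pdivrMr//; lra.
Qed.

Lemma sphere_ratio_bound_near_point z : ~ ch mu z -> locally_bounded (Some z).
Proof.
move=> nz; have [M M0 hM] := supp_bounded.
have [u [d [u1 d0 hd]]] : exists u d, [/\ normc u <= 1, 0 < d &
    forall w, supp mu w -> d <= complex.Re (u * (w - z))].
  apply: (@compact_separation _ _ (ch mu)) => //.
  - exact: sub_gen_smallest.
  - move=> a b t /set_mem Xa /set_mem Xb; apply/mem_set => A [cA sA].
    by apply/set_mem/cA; apply/mem_set; [apply: Xa|apply: Xb].
have d2 : 0 < d / 2 by rewrite divr_gt0.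
(* The normal [u] found at z is kept for all v with |v - z| < d/2: the gap shrinks to no less than
   d/2, and the support stays within M + |z| + d/2 of v. *)
exists ((M + normc z + d / 2) / (d / 2)).
  by rewrite divr_ge0 ?addr_ge0 ?normc_ge0// ltW.
suff : \forall v \near z, normc (v - z) < d / 2.
  apply: filterS => v vz n n0.
  apply: (sphere_ratio_some n0 d2 u1 _ _) => w sw.
  - have -> : u * (w - v) = u * (w - z) - u * (v - z) by ring.
    rewrite raddfB/=.
    have h1 := hd _ sw.
    have h2 : complex.Re (u * (v - z)) <= d / 2.
      apply: (le_trans (ler_norm _)); apply: (le_trans (normc_ge_abs_Re _)).
      rewrite ComplexField.Normc.normcM; apply: le_trans (ltW vz).
      by rewrite ler_piMl ?normc_ge0.
    by rewrite [X in X <= _](_ : _ = d - d / 2); lra.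
  - have -> : w - v = w - z - (v - z) by ring.
    apply: (le_trans (le_normcD _ _)); rewrite normcN lerD ?(ltW vz)//.
    by apply: (le_trans (le_normcD _ _)); rewrite normcN lerD2r hM.
have oU := @normc_lt_open R z (d / 2).
by apply: (open_nbhs_nbhs (conj oU _)); rewrite /= subrr ComplexField.Normc.normc0.
Qed.

Lemma sphere_ratio_uniform (K : set (riemann_sphere R)) :
  E @ \oo --> (0 : R) -> compact K -> K `<=` ~` (Some @` ch mu) ->
  {uniform K, F @ \oo --> (fun=> 1 : R[i])}.
Proof.
move=> E0 /compact_near_coveringP cK Kch P /uniform_nbhs[V [entV VP]].
have [e e0 eV] : exists2 e : R, 0 < e & forall z, normc (z - 1) < e -> V (1, z).
  move: entV; rewrite -entourage_from_ballE => -[e /= e0 eV].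
  have [r eE] : exists r, e = r%:C.
    by exists (complex.Re e); rewrite RRe_real// gtr0_real.
  exists r => [|z zr]; first by rewrite -ltcR -eE.
  by apply: eV; rewrite -ball_normE/= eE distrC normC_normc ltcR.
suff : \forall n \near \oo, K `<=` (fun w => normc (F n w - 1) < e).
  by apply: filterS => n Kn; apply: VP => w Kw; exact/eV/Kn.
(* Compactness in covering form: an inequality valid jointly for v near each w in [K] and for large
   n holds for large n on all of [K]. *)
apply: cK => w Kw.
have [C C0 wC] : locally_bounded w.
  case: w Kw => [z|] Kw; last exact: sphere_ratio_bound_near_infty.
  by apply: sphere_ratio_bound_near_point => chz; apply: (Kch _ Kw); exists z.
have EC0 : E n + C * Num.sqrt (E n) @[n --> \oo] --> (0 : R).
  rewrite -[0 in X in _ --> X]addr0; apply: cvgD => //.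
  rewrite -[0](mulr0 C); apply: cvgM; first exact: cvg_cst.
  rewrite -(sqrtr0 R); apply: (@continuous_cvg _ _ _ _ _ _ Num.sqrt) => //.
  exact: sqrt_continuous.
have near_n : \forall n \near \oo, (0 < n)%N /\ E n + C * Num.sqrt (E n) < e.
  near=> n; split; first by near: n; exact: nbhs_infty_gt.
  by near: n; exact: (cvgr_lt _ EC0).
exists ([set v | forall n, (0 < n)%N ->
  normc (F n v - 1) <= E n + C * Num.sqrt (E n)],
  [set n | (0 < n)%N /\ E n + C * Num.sqrt (E n) < e]) => //.
by move=> [v n] /= [vC [n0]]; apply: le_lt_trans; exact: vC.
Unshelve. all: by end_near.
Qed.

End sphere_estimates.

Unset Implicit Arguments.
Local Open Scope complex_scope.

Theorem theorem5p2 (R : realType)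
    (mu : {finite_measure set (borelC R) -> \bar R}) (x : R[i]) :
  compact (supp mu) ->
  infinite_set (supp mu) ->
  (fun n : nat => normc (orthonormal_poly mu n).[x] ^+ 2 /
     \sum_(j < n) normc (orthonormal_poly mu j).[x] ^+ 2) @ \oo --> (0 : R) ->
  forall K : set (riemann_sphere R),
    compact K -> K `<=` ~` (Some @` ch mu) ->
    {uniform K,
      (fun n : nat => sphere_ratio
         (('X - x%:P) * orthonormal_poly (nux mu x) n.-1)
         (orthonormal_poly mu n)) @ \oo --> (fun=> 1 : R[i])}.
Proof. by move=> cS iS E0 K; exact: sphere_ratio_uniform. Qed.
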